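(* Let $G=\mathbb{Z}$ be generated as a semigroup by the finite symmetric set $S\subseteq\mathbb{Z}\setminus\{0\}$, with edge lengths $l$, such that $-1,1\in S$, $|S|\ge 3$ and $l(s)<|s|\cdot l(1)$ for some $s\in S\setminus\{-1,1\}$ (where $|s|$ is the absolute value of the integer $s$). Let $(Z_n)_{n\in\mathbb{N}_0}=((\eta_n,X_n))_{n\in\mathbb{N}_0}$ be a lamplighter random walk on $\mathbb{Z}_2\wr \mathbb{Z}$ as described in the context, whose projection $(X_n)_{n\in\mathbb{N}_0}$ onto $\mathbb{Z}$ is transient. Then $$\ell\ \ge\ \ell_{\mathrm{TS}}\ >\ \ell_0 .$$
   Context: Write $G=\mathbb{Z}$ with identity $e=0$. Each $s\in S$ has a length $l(s)=l(-s)>0$. The metric on $G$ is $d(x,y)=\min\{\sum_{i=1}^n l(s_i) : s_1,\dots,s_n\in S,\ y=x+s_1+\cdots+ s_n\}$. A path in $G$ is a finite sequence $[x_0,\dots,x_n]$ with $x_i-x_{i-1}\in S$; its length is $\sum_i l(x_i-x_{i-1})$. $\mathbb{Z}_2=\mathbb{Z}/2\mathbb{Z}$; $\mathcal{N}$ is the set of finitely supported $\eta:G\to\mathbb{Z}_2$; $\mathbf{0}$ is the zero configuration. $\mathcal{L}=\mathbb{Z}_2\wr G$ is $\mathcal{N}\times G$ with product $(\eta_1,x)(\eta_2,y)=(\eta_1\oplus x\eta_2,x+y)$, where $(x\eta)(w)=\eta(w-x)$ and $\oplus$ is componentwise addition mod 2. $d_{\mathrm{TS}}(\eta,x)$ is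 the minimal length of a path in $G$ from $0$ to $x$ that visits every $y\in\mathrm{supp}(\eta)$. With a fixed constant $c_{\mathcal{L}}\ge 0$, $\ell(\eta,x):=d_{\mathrm{TS}}(\eta,x)+c_{\mathcal{L}}\,|\mathrm{supp}(\eta)|$, where here $|\cdot|$ is cardinality. Lamplighter random walk: $(\mathbf{i}_n)_{n\ge1}$ are i.i.d. $\mathcal{L}$-valued with law $\mu$, $Z_0=(\mathbf{0},0)$, $Z_n=Z_{n-1}\mathbf{i}_n$, $Z_n=(\eta_n,X_n)$. Assumptions: $(Z_n)$ is irreducible (every element of $\mathcal{L}$ is reached from every other with positive probability) and transient, and (1) $\langle\mathrm{supp}(\mu)\rangle=\mathcal{L}$; (2) there is $R\ge0$ such that $\mu(\eta,x)>0$ implies $d(0,y)\le R$ for all $y\in\mathrm{supp}(\eta)$; (3) $\sum_{(\eta,x)\in\mathcal{L}}d(0,x)\mu(\eta,x)<\infty$. The projection $(X_n)$ is assumed transient. The following limits exist almost surely and are constant (Kingman's subadditive ergodic theorem): $\ell_0=\lim_n d(0,X_n)/n$, $\ell_{\mathrm{TS}}=\lim_n d_{\mathrm{TS}}(\eta_n,X_n)/n$, $\ell=\lim_n \ell(Z_n)/n$. *)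

(* Defs.v *)
From HB Require Import structures.
From mathcomp Require Import all_boot all_order all_algebra finmap.
From mathcomp Require Import all_classical all_reals all_analysis.

Set Implicit Arguments.
Unset Strict Implicit.
Unset Printing Implicit Defensive.

Import Order.TTheory GRing.Theory Num.Theory.
Import numFieldNormedType.Exports.

Local Open Scope classical_set_scope.
Local Open Scope ring_scope.

Definition symmetric_gen (S : {fset int}) : Prop :=
  forall s : int, s \in S -> - s \in S.

Definition semigroup_generates (S : {fset int}) : Prop :=
  forall x : int, exists w : seq int,
    [/\ (0 < size w)%N, {subset w <= S} & x = \sum_(s <- w) s].

Definition edge_length (R : realType) (S : {fset int}) (l : int -> R) : Prop :=
  forall s : int, s \in S -> 0 < l s /\ l (- s) = l s.

(* The infimum is a minimum for finite S and positive lengths, since then only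
   finitely many words have length below a given bound.  The empty word is
   allowed, so that the distance of x to itself is 0. *)
Definition gdist (R : realType) (S : {fset int}) (l : int -> R) (x y : int) : R :=
  inf [set r | exists w : seq int,
    [/\ {subset w <= S}, y = x + \sum_(s <- w) s & r = \sum_(s <- w) l s]].

(* The list p represents the path [x_0; x_1; ...; x_n] = x :: p. *)
Definition gpath (S : {fset int}) (x : int) (p : seq int) : bool :=
  path (fun y z : int => z - y \in S) x p.

Definition gpath_length (R : realType) (l : int -> R) (x : int) (p : seq int) : R :=
  \sum_(s <- pairmap (fun y z : int => z - y) x p) l s.

Definition config : Type := {fsfun int -> 'Z_2 with 0}.

Definition config0 : config := [fsfun].

Definition config_add (a b : config) : config :=
  [fsfun w in (finsupp a `|` finsupp b)%fset => a w + b w].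

Definition config_shift (x : int) (a : config) : config :=
  [fsfun w in [fset (y + x)%R | y in finsupp a]%fset => a (w - x)].

Lemma config0E (w : int) : config0 w = 0.
Proof. by rewrite /config0 fsfunE. Qed.

Lemma config_addE (a b : config) (w : int) : config_add a b w = a w + b w.
Proof.
rewrite /config_add fsfunE inE; case: ifP => // /negbT.
by rewrite negb_or => /andP[wa wb]; rewrite !fsfun_dflt ?addr0.
Qed.

Lemma config_shiftE (x : int) (a : config) (w : int) :
  config_shift x a w = a (w - x).
Proof.
rewrite /config_shift fsfunE; case: ifP => // /negbT wx.
rewrite fsfun_dflt //; apply: contra wx => wx.
by apply/imfsetP; exists (w - x) => //=; rewrite subrK.
Qed.

Record lamplighter : Type := Lamplighter { lamps : config; pos : int }.

Definition lamplighter_mul (g h : lamplighter) : lamplighter :=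
  Lamplighter (config_add (lamps g) (config_shift (pos g) (lamps h)))
              (pos g + pos h).

Definition lamplighter_one : lamplighter := Lamplighter config0 0.

(* Configurations are their own additive inverses in characteristic 2. *)
Definition lamplighter_inv (g : lamplighter) : lamplighter :=
  Lamplighter (config_shift (- pos g) (lamps g)) (- pos g).

Definition pair_of_lamplighter (g : lamplighter) : config * int :=
  (lamps g, pos g).

Definition lamplighter_of_pair (u : config * int) : lamplighter :=
  Lamplighter u.1 u.2.

Lemma pair_of_lamplighterK : cancel pair_of_lamplighter lamplighter_of_pair.
Proof. by case. Qed.

HB.instance Definition _ :=
  Countable.copy lamplighter (can_type pair_of_lamplighterK).

HB.instance Definition _ := isPointed.Build lamplighter lamplighter_one.

Lemma lamplighter_eq (g h : lamplighter) :
  lamps g =1 lamps h -> pos g = pos h -> g = h.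
Proof. by case: g h => [a x] [b y] /= /fsfunP -> ->. Qed.

Lemma lamplighter_mulA : associative lamplighter_mul.
Proof.
move=> g h k; apply: lamplighter_eq => [w|] /=; last by rewrite addrA.
by rewrite !(config_addE, config_shiftE) addrA opprD addrA.
Qed.

Lemma lamplighter_mul1g : left_id lamplighter_one lamplighter_mul.
Proof.
move=> g; apply: lamplighter_eq => [w|] /=; last by rewrite add0r.
by rewrite !(config_addE, config_shiftE, config0E) add0r subr0.
Qed.

Lemma lamplighter_mulg1 : right_id lamplighter_one lamplighter_mul.
Proof.
move=> g; apply: lamplighter_eq => [w|] /=; last by rewrite addr0.
by rewrite !(config_addE, config_shiftE, config0E) addr0.
Qed.

Lemma Z2_addrr (a : 'Z_2) : a + a = 0.
Proof. by case: a => [[|[|]]] // ?; apply/val_inj. Qed.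

Lemma lamplighter_mulVg :
  left_inverse lamplighter_one lamplighter_inv lamplighter_mul.
Proof.
move=> g; apply: lamplighter_eq => [w|] /=; last by rewrite addNr.
by rewrite !(config_addE, config_shiftE, config0E) Z2_addrr.
Qed.

Lemma lamplighter_mulgV :
  right_inverse lamplighter_one lamplighter_inv lamplighter_mul.
Proof.
move=> g; apply: lamplighter_eq => [w|] /=; last by rewrite addrN.
by rewrite !(config_addE, config_shiftE, config0E) opprK subrK Z2_addrr.
Qed.

HB.instance Definition _ := isGroup.Build lamplighter
  lamplighter_mulA lamplighter_mul1g lamplighter_mulg1
  lamplighter_mulVg lamplighter_mulgV.

(* The countable group carries the discrete sigma-algebra. *)
HB.instance Definition _ := @isMeasurable.Build default_measure_display
  lamplighter discrete_measurable discrete_measurable0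
  discrete_measurableC discrete_measurableU.

Definition TS_length (R : realType) (S : {fset int}) (l : int -> R)
    (g : lamplighter) : R :=
  inf [set r | exists p : seq int,
    [/\ gpath S 0 p, last 0 p = pos g, {subset finsupp (lamps g) <= 0 :: p}
      & r = gpath_length l 0 p]].

Definition lamp_length (R : realType) (S : {fset int}) (l : int -> R) (cL : R)
    (g : lamplighter) : R :=
  TS_length S l g + cL * #|` finsupp (lamps g)|%:R.

Definition subgroup_generated (G : groupType) (A : set G) : set G :=
  [set g | forall H : {pred G},
     group_closed H -> (forall h : G, A h -> h \in H) -> g \in H].

Definition law_support d (U : measurableType d) (R : realType)
    (mu : probability U R) : set U :=
  [set g | (0 < mu [set g])%E].

Definition independent_seq d (T : measurableType d) (R : realType)
    (P : probability T R) d' (U : measurableType d')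
    (X : nat -> {RV P >-> U}) : Prop :=
  forall (J : {fset nat}) (A : nat -> set U),
    (forall k : nat, measurable (A k)) ->
    P (\bigcap_(k in [set` J]) (X k @^-1` A k)) =
      (\prod_(k <- J) P (X k @^-1` A k))%E.

Definition iid_with_law d (T : measurableType d) (R : realType)
    (P : probability T R) d' (U : measurableType d')
    (X : nat -> {RV P >-> U}) (mu : probability U R) : Prop :=
  independent_seq X /\
  forall (n : nat) (A : set U), measurable A -> distribution P (X n) A = mu A.

(* inc n is the increment between the times n and n.+1. *)
Fixpoint walk_from d (T : measurableType d) (R : realType)
    (P : probability T R) (g : lamplighter)
    (inc : nat -> {RV P >-> lamplighter}) (n : nat) (w : T) : lamplighter :=
  if n is m.+1 then (walk_from g inc m w * inc m w)%g else g.

Definition lamp_walk d (T : measurableType d) (R : realType)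
    (P : probability T R) (inc : nat -> {RV P >-> lamplighter}) :
    nat -> T -> lamplighter :=
  walk_from 1%g inc.

Definition irreducible_walk d (T : measurableType d) (R : realType)
    (P : probability T R) (inc : nat -> {RV P >-> lamplighter}) : Prop :=
  forall g h : lamplighter, exists n : nat,
    (0 < P [set w | walk_from g inc n w = h])%E.

(* For a Markov chain started at x0: the return probability to x0 is < 1. *)
Definition transient_at d (T : measurableType d) (R : realType)
    (P : probability T R) (U : Type) (x0 : U) (Y : nat -> T -> U) : Prop :=
  (P [set w | exists n : nat, (0 < n)%N /\ Y n w = x0] < 1)%E.

Definition as_rate d (T : measurableType d) (R : realType)
    (P : probability T R) (Y : nat -> T -> R) (c : R) : Prop :=
  {ae P, forall w : T, (Y n w / n%:R) @[n --> \oo] --> c}.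

(* Main.v *)
Require Import Defs.
From mathcomp Require Import all_boot all_order all_algebra finmap.
From mathcomp Require Import all_classical all_reals all_analysis.
From mathcomp Require Import measurable_realfun zify ring lra.

Set Implicit Arguments.
Unset Strict Implicit.
Unset Printing Implicit Defensive.

Import Order.TTheory GRing.Theory Num.Theory.
Import numFieldNormedType.Exports.

Local Open Scope classical_set_scope.
Local Open Scope ring_scope.

(** Let v be the least value of l(s)/|s| over the edges s.  Then the distance
    from 0 to x is v|x| up to a bounded error ([efficient_edge], [gdist_le]),
    and v < l(1) because some edge is a shortcut.  A path of length close to
    v|x| hardly ever uses unit edges and hardly ever turns back; hence it can
    visit few pairs of adjacent sites.  Quantitatively, a path from 0 to x that
    visits both a and a + 1 either uses the edge between them, which costs
    l(1) - v too much, or crosses one of the three unit intervals at this pair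
    more often than a path from 0 to x has to.  These local excesses add up
    ([path_edge_cost_ge]), so that the travelling salesman length of (eta, x)
    is at least v|x| + k N, where k > 0 and N is the number of sites a such
    that a and a + 1 are lit ([TS_length_ge]).

    It remains to see that the number N of lit pairs in the lamplighter
    configuration grows linearly, and for this the transience of the projection
    suffices.  Cut time into blocks of M steps.  By irreducibility M can be
    chosen such that four words of length M with displacement 0 have the four
    possible effects on the lamps at the sites 0 and 1 ([lamp_words]).  A block
    that starts at a and realises one of these words does not influence where
    the other increments act; given all of these, one of the four words leads
    to a and a + 1 being lit in the end.  Since the blocks are independent and
    the walk escapes with positive probability, each block has a probability
    bounded below to leave a lit pair at a and never to return to a
    ([prob_marks_pair]); distinct such blocks have distinct sites a
    ([uniq_marked_sites]).  So the expected number of lit pairs is linear in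
    time, the number itself is linear with a probability bounded below, and
    this happens at infinitely many times with positive probability
    ([frequently_many_marking_blocks]).  As the limits are almost sure, they
    can be compared at one outcome of this event. *)

(** * Paths through a pair of adjacent sites *)

Fixpoint path_sum (V : nmodType) (T : Type) (c : T -> T -> V) (x : T)
    (p : seq T) : V :=
  if p is y :: p' then c x y + path_sum c y p' else 0.

Section QuasiMetric.
Variables (T : eqType) (c : T -> T -> int).
Hypotheses (c0 : forall x, c x x = 0)
  (ctri : forall y x z, c x z <= c x y + c y z).

Lemma path_sum_ge_ends x p : c x (last x p) <= path_sum c x p.
Proof.
elim: p x => [|y p IH] x /=; first by rewrite c0.
by apply: le_trans (ctri y _ _) _; rewrite lerD2l.
Qed.

Lemma path_sum_ge_visit x p y : y \in x :: p ->
  c x y + c y (last x p) <= path_sum c x p.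
Proof.
elim: p x => [|z p IH] x /=.
  by rewrite inE => /eqP ->; rewrite c0.
rewrite inE => /predU1P[->|/IH {}IH].
  by rewrite c0 add0r; apply: (path_sum_ge_ends x (z :: p)).
by have := ctri z x y; lia.
Qed.

(** Of two visited points one comes first on the path, and the triangle
    inequality applies to the three stretches that they delimit. *)
Lemma path_sum_ge_visit2 x p y z : y \in x :: p -> z \in x :: p ->
  c x y + c y z + c z (last x p) <= path_sum c x p \/
  c x z + c z y + c y (last x p) <= path_sum c x p.
Proof.
elim: p x => [|t p IH] x.
  by rewrite !inE => /eqP -> /eqP ->; left; rewrite /= !c0.
rewrite in_cons => /predU1P[-> zp|yp].
  by left; rewrite c0 add0r; apply: path_sum_ge_visit.
rewrite in_cons => /predU1P[->|zp].
  right; rewrite c0 add0r; apply: path_sum_ge_visit.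
  by rewrite in_cons yp orbT.
have [] := IH _ yp zp => /= H; [left; have := ctri t x y|right; have := ctri t x z];
  by lia.
Qed.

End QuasiMetric.

(** Seen from the pair {a, a + 1} the line has four zones: 0 to the left of a,
    1 at a, 2 at a + 1, and 3 to the right.  The zone of y counts how many of
    the unit intervals [a-1, a], [a, a+1] and [a+1, a+2] lie to the left of y,
    so that the difference of two zones counts those that a move crosses. *)
Definition zone (a y : int) : int := Num.max 0 (Num.min 3 (y - a + 1)).

(** The number of unit intervals near the pair that are crossed, with a
    surcharge of 1 for stepping directly from a to a + 1 or back.  With the
    surcharge it remains a metric on the four zones, and the pair is at
    distance 2: a path that meets both a and a + 1 either uses the unit edge
    between them or makes a detour. *)
Definition zone_cost (u v : int) : int :=
  `|u - v| + (((u == 1) && (v == 2)) || ((u == 2) && (v == 1)))%:Z.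

Definition site_cost (a y z : int) : int :=
  zone_cost (zone a y) (zone a z).

Lemma zoneP a y : zone a y \in [:: 0; 1; 2; 3].
Proof. rewrite /zone !inE; lia. Qed.

Lemma site_cost0 a y : site_cost a y y = 0.
Proof. rewrite /site_cost /zone_cost; lia. Qed.

Lemma site_cost_tri a y x z : site_cost a x z <= site_cost a x y + site_cost a y z.
Proof.
rewrite /site_cost; move: (zoneP a x) (zoneP a y) (zoneP a z).
rewrite !inE.
by do 3![case/or4P=> /eqP ->].
Qed.

(** Visiting both points costs at least one more than the crossings that the
    endpoints force: the direct way between zones 1 and 2 costs 2 and not 1. *)
Lemma site_cost_pair a x p : a \in x :: p -> a + 1 \in x :: p ->
  `|zone a x - zone a (last x p)| + 1 <= path_sum (site_cost a) x p.
Proof.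
move=> ap a1p.
have pa : zone a a = 1 by rewrite /zone; lia.
have pa1 : zone a (a + 1) = 2 by rewrite /zone; lia.
have [] := path_sum_ge_visit2 (site_cost0 a) (site_cost_tri a) ap a1p;
  apply: le_trans; rewrite /site_cost pa pa1;
  move: (zoneP a x) (zoneP a (last x p));
  by rewrite !inE; do 2![case/or4P=> /eqP ->].
Qed.

Lemma site_cost_ends a x p :
  `|zone a x - zone a (last x p)| <= path_sum (site_cost a) x p.
Proof.
apply: le_trans (path_sum_ge_ends (site_cost0 a) (site_cost_tri a) x p).
by rewrite /site_cost /zone_cost lerDl.
Qed.

(** Moving y by one is the same as moving the window by one, so the sum over a
    window of pairs telescopes. *)
Lemma sum_zoneS (b : int) m (y : int) :
  \sum_(i < m) zone (b + i%:Z) (y + 1) =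
  \sum_(i < m) zone (b + i%:Z) y
  + (zone (b - 1) y - zone (b + m%:Z - 1) y).
Proof.
elim: m => [|m IH]; first by rewrite !big_ord0 addr0 subrr addr0.
rewrite !big_ord_recr /= IH.
have -> : zone (b + m%:Z) (y + 1) = zone (b + m%:Z - 1) y.
  rewrite /zone; lia.
have -> : b + m.+1%:Z - 1 = b + m%:Z by lia.
ring.
Qed.

Lemma sum_zone_shift (b : int) m (y : int) (n : nat) :
  \sum_(i < m) zone (b + i%:Z) (y + n%:Z) <=
    \sum_(i < m) zone (b + i%:Z) y + 3 * n%:Z.
Proof.
elim: n => [|n IH]; first by rewrite mulr0 !addr0.
have -> : y + n.+1%:Z = y + n%:Z + 1 by lia.
rewrite sum_zoneS.
have : zone (b - 1) (y + n%:Z) - zone (b + m%:Z - 1) (y + n%:Z) <= 3.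
  by rewrite /zone; lia.
lia.
Qed.

Lemma sum_zone_shift_eq (b : int) m (y : int) (n : nat) :
  b < y -> y + n%:Z < b + m%:Z ->
  \sum_(i < m) zone (b + i%:Z) (y + n%:Z) =
    \sum_(i < m) zone (b + i%:Z) y + 3 * n%:Z.
Proof.
move=> by_; elim: n => [|n IH] yb; first by rewrite mulr0 !addr0.
have -> : y + n.+1%:Z = y + n%:Z + 1 by lia.
rewrite sum_zoneS IH; last by lia.
have : zone (b - 1) (y + n%:Z) - zone (b + m%:Z - 1) (y + n%:Z) = 3.
  by rewrite /zone; lia.
lia.
Qed.

Lemma sum_dist_zone (b : int) m (y : int) (n : nat) :
  \sum_(i < m) `|zone (b + i%:Z) y - zone (b + i%:Z) (y + n%:Z)| =
  \sum_(i < m) zone (b + i%:Z) (y + n%:Z)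
  - \sum_(i < m) zone (b + i%:Z) y.
Proof.
rewrite -sumrB; apply: eq_bigr => i _; rewrite /zone; lia.
Qed.

Lemma sum_eq_window (b v : int) m :
  \sum_(i < m) (b + i%:Z == v)%:Z = ((b <= v) && (v < b + m%:Z))%:Z.
Proof. elim: m => [|m IH]; rewrite ?big_ord0 ?big_ord_recr /= ?IH; lia. Qed.

(** The sum of [site_cost a y z] over all integers a: every unit interval
    between y and z is seen by three pairs, and a unit edge is surcharged by
    exactly one pair. *)
Definition edge_cost (y z : int) : int := 3 * `|z - y| + (`|z - y| == 1)%:Z.

Lemma int_dist_ind (Q : int -> int -> Prop) :
  (forall y z, Q y z -> Q z y) -> (forall y (n : nat), Q y (y + n%:Z)) ->
  forall y z, Q y z.
Proof.
move=> Qs Qn y z; case: (leP y z) => yz.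
  have -> : z = y + `|z - y|%N%:Z by lia.
  exact: Qn.
apply: Qs; have -> : y = z + `|z - y|%N%:Z by lia.
exact: Qn.
Qed.

Lemma sum_site_cost (b : int) m (y z : int) :
  \sum_(i < m) site_cost (b + i%:Z) y z <= edge_cost y z.
Proof.
move: y z; apply: int_dist_ind => [y z|y n].
  have -> : edge_cost z y = edge_cost y z by rewrite /edge_cost; lia.
  apply: le_trans; apply: ler_sum => i _.
  by rewrite /site_cost /zone_cost distrC orbC ![(_ == 1) && _]andbC.
rewrite /site_cost /zone_cost big_split /= sum_dist_zone.
have -> : edge_cost y (y + n%:Z) = 3 * n%:Z + (n == 1%N)%:Z.
  by rewrite /edge_cost; lia.
apply: lerD; first by have := sum_zone_shift b m y n; lia.
apply: (@le_trans _ _ (\sum_(i < m) (if n == 1%N then (b + i%:Z == y)%:Z else 0))).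
  by apply: ler_sum => i _; case: ifP; rewrite /zone; lia.
case: (n == 1%N); last by rewrite big1.
rewrite sum_eq_window; lia.
Qed.

Lemma sum_dist_zone_ends (b : int) m (y z : int) :
  b < y -> b < z -> y < b + m%:Z -> z < b + m%:Z ->
  \sum_(i < m) `|zone (b + i%:Z) y - zone (b + i%:Z) z| = 3 * `|z - y|.
Proof.
move: y z; apply: int_dist_ind => [y z H zb yb zm ym|y n yb _ ym nm].
  by rewrite distrC -H //; apply: eq_bigr => i _; rewrite distrC.
rewrite sum_dist_zone sum_zone_shift_eq //; lia.
Qed.

Lemma path_sum_sum (T : Type) m (c : 'I_m -> T -> T -> int) x p :
  \sum_(i < m) path_sum (c i) x p = path_sum (fun y z => \sum_(i < m) c i y z) x p.
Proof.
by elim: p x => [|y p IH] x /=; [rewrite big1|rewrite big_split /= IH].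
Qed.

Lemma le_path_sum (R : numDomainType) (T : Type) (c c' : T -> T -> R) x p :
  (forall y z, c y z <= c' y z) -> path_sum c x p <= path_sum c' x p.
Proof. by move=> cc; elim: p x => //= y p IH x; apply: lerD. Qed.

Lemma size_le_sum_window (s : seq int) (b : int) m : uniq s ->
  (forall a, a \in s -> b <= a < b + m%:Z) ->
  (size s)%:Z <= \sum_(i < m) (b + i%:Z \in s)%:Z.
Proof.
elim: s => [|a s IH] /=; first by move=> _ _; apply: sumr_ge0.
move=> /andP[as_ us] sb.
have -> : (size s).+1%:Z = \sum_(i < m) (b + i%:Z == a)%:Z + (size s)%:Z.
  rewrite sum_eq_window; have := sb a (mem_head _ _); lia.
apply: (@le_trans _ _ (\sum_(i < m) (b + i%:Z == a)%:Z
                       + \sum_(i < m) (b + i%:Z \in s)%:Z)).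
  rewrite lerD2l; apply: IH => // a' a's; apply: sb; by rewrite inE a's orbT.
rewrite -big_split /=; apply: ler_sum => i _; rewrite inE.
case: eqVneq => [->|]; last by rewrite add0r.
by rewrite (negbTE as_).
Qed.

(** Summing the local estimates over all pairs: each pair whose two points are
    visited contributes one unit of excess over the unavoidable
    [3 * `|last x p - x|]. *)
Lemma path_edge_cost_ge (x : int) p (s : seq int) : uniq s ->
  (forall a, a \in s -> a \in x :: p /\ a + 1 \in x :: p) ->
  3 * `|last x p - x| + (size s)%:Z <= path_sum edge_cost x p.
Proof.
move=> us sp; set t := last x p.
(* The window [-B, B) holds the endpoints and all of s in its interior. *)
pose B := (\max_(a <- s) `|a|%N + `|x| + `|t| + 1)%N.
pose b := - B%:Z; pose m := (B + B)%N.
have sB a : a \in s -> b <= a < b + m%:Z.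
  move=> as_; have : (`|a| <= \max_(a <- s) `|a|%N)%N.
    by apply: (@leq_bigmax_seq _ _ xpredT (fun a : int => `|a|%N)).
  rewrite /b /m /B; lia.
rewrite -(@sum_dist_zone_ends b m); try by rewrite /b /m /B; lia.
apply: le_trans (lerD (lexx _) (size_le_sum_window us sB)) _.
rewrite -big_split /=.
apply: (@le_trans _ _ (\sum_(i < m) path_sum (site_cost (b + i%:Z)) x p)).
  apply: ler_sum => i _; case: (boolP (_ \in s)) => [/sp[]|_].
    exact: site_cost_pair.
  by rewrite addr0; apply: site_cost_ends.
rewrite (path_sum_sum (fun i : 'I_m => site_cost (b + i%:Z))).
apply: le_path_sum => y z; exact: sum_site_cost.
Qed.

(** * Word distance and travelling salesman length *)

Lemma gpath_lengthE (R : realType) (l : int -> R) x p :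
  gpath_length l x p = path_sum (fun y z => l (z - y)) x p.
Proof.
rewrite /gpath_length; elim: p x => [|y p IH] x /=; first by rewrite big_nil.
by rewrite big_cons IH.
Qed.

Lemma gpath_to (S : {fset int}) (S_gen : semigroup_generates S) (x y : int) :
  exists p, gpath S x p /\ last x p = y.
Proof.
have [w [_ wS]] := S_gen (y - x); move=> yx.
have -> : y = x + \sum_(s <- w) s by rewrite -yx addrC subrK.
elim: w x wS {yx} => [|s w IH] x wS; first by exists [::]; rewrite big_nil addr0.
have [|p [px lp]] := IH (x + s); first by move=> t tw; apply: wS; rewrite inE tw orbT.
exists (x + s :: p); split; last by rewrite /= lp big_cons addrA.
by rewrite /gpath /= addrAC subrr add0r wS ?mem_head.
Qed.

(** The infimum that defines [TS_length] is over a nonempty set; otherwise it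
    would be 0 and admit no lower bound. *)
Lemma gpath_through (S : {fset int}) (S_gen : semigroup_generates S)
    (vs : seq int) (x y : int) :
  exists p, [/\ gpath S x p, last x p = y & {subset vs <= x :: p}].
Proof.
elim: vs x => [|v vs IH] x.
  by have [p [px py]] := gpath_to S_gen x y; exists p.
have [p [px pv]] := gpath_to S_gen x v; have [q [qv qy qs]] := IH v.
exists (p ++ q); split.
- by rewrite /gpath cat_path -/(gpath S x p) px pv.
- by rewrite last_cat pv.
- move=> u; rewrite inE -cat_cons mem_cat => /predU1P[->|/qs].
    by rewrite -pv mem_last.
  by rewrite inE => /predU1P[->|->]; [rewrite -pv mem_last|rewrite orbT].
Qed.

(** The least length per unit of displacement is attained because S is finite,
    and by symmetry it is attained at a positive edge. *)
Lemma efficient_edge (R : realType) (S : {fset int}) (l : int -> R)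
    (S_neq0 : 0 \notin S) (S_sym : symmetric_gen S)
    (l_length : edge_length S l) (S_1 : 1 \in S) :
  exists s0 : nat, [/\ (0 < s0)%N, s0%:Z \in S &
    forall s, s \in S -> l s0 / s0%:R * `|s|%N%:R <= l s].
Proof.
have S_gt0 s : s \in S -> (0 < `|s|)%N.
  by move=> sS; rewrite absz_gt0; apply: contraNneq S_neq0 => <-.
pose f (s : S) : R := l (val s) / `|val s|%N%:R.
have [/= s _ smin] := @Order.TotalTheory.arg_minP _ _ _ [` S_1]%fset xpredT f isT.
have l_abs t : t \in S -> l `|t|%N%:Z = l t.
  move=> tS; have [] := l_length _ tS.
  by case: (intP t) => [|n|n] //= _ <-; rewrite ?opprK.
have abs_S t : t \in S -> `|t|%N%:Z \in S.
  by case: (intP t) => [|n|n] // /S_sym; rewrite opprK.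
exists `|val s|%N; split.
- exact/S_gt0/fsvalP.
- exact/abs_S/fsvalP.
- move=> t tS; have := smin [` tS]%fset isT; rewrite /f /= l_abs ?fsvalP // => H.
  by rewrite -ler_pdivlMr // ltr0n S_gt0.
Qed.

Lemma gpath_length_ge (R : realType) (S : {fset int}) (l : int -> R)
    (c c' : int -> int -> int) (a b : R) x p :
  (forall y z, z - y \in S ->
     a * (c y z)%:~R + b * (c' y z)%:~R <= l (z - y)) ->
  gpath S x p ->
  a * (path_sum c x p)%:~R + b * (path_sum c' x p)%:~R <= gpath_length l x p.
Proof.
move=> H; rewrite gpath_lengthE /gpath; elim: p x => [|y p IH] x /=.
  by rewrite !mulr0 addr0.
move=> /andP[yx /IH]; have := H _ _ yx; rewrite !intrD; lra.
Qed.

(** With v the least length per unit of displacement, an edge s of length at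
    least [v * |s|], and of length [l 1 >= v + k] when it is a unit edge, has
    length at least k times its [edge_cost] plus [v - 3 * k] times its
    displacement; both terms are bounded below along the whole path. *)
Lemma TS_length_ge (R : realType) (S : {fset int}) (l : int -> R)
    (S_gen : semigroup_generates S)
    (l1 : forall s, s \in S -> `|s|%N = 1%N -> l s = l 1)
    (v k : R) (k_ge0 : 0 <= k) (k_v : k * 3 <= v) (k_l : v + k <= l 1)
    (v_min : forall s, s \in S -> v * `|s|%N%:R <= l s)
    (g : lamplighter) (s : seq int) :
  uniq s -> (forall a, a \in s ->
    a \in finsupp (lamps g) /\ a + 1 \in finsupp (lamps g)) ->
  v * `|pos g|%N%:R + k * (size s)%:R <= TS_length S l g.
Proof.
move=> us sg; apply: lb_le_inf.
  have [p [px pl ps]] := gpath_through S_gen (finsupp (lamps g)) 0 (pos g).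
  by exists (gpath_length l 0 p), p.
move=> _ [p [px pl ps ->]].
have sp a : a \in s -> a \in 0 :: p /\ a + 1 \in 0 :: p.
  by move=> /sg[? ?]; split; apply: ps.
pose c (y z : int) : int := `|z - y|.
have c0 y : c y y = 0 by rewrite /c subrr normr0.
have ctri y x z : c x z <= c x y + c y z by rewrite /c; lia.
have := path_edge_cost_ge us sp; have := path_sum_ge_ends c0 ctri 0 p.
rewrite pl subr0 /c subr0 -/c => Hc He.
apply: le_trans (gpath_length_ge (a := k) (b := v - k * 3) (c := edge_cost)
  (c' := c) _ px); last first.
  move=> y z yz; rewrite /edge_cost /c; have := v_min _ yz; have := l1 _ yz.
  set t := z - y; rewrite intrD intrM -abszE.
  have -> : (`|t|%N%:Z == 1) = (`|t|%N == 1%N) by [].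
  case: eqP => [-> /(_ erefl) ->|_ _] /=; lra.
have {}He : 3 * `|pos g|%N%:R + (size s)%:R <= (path_sum edge_cost 0 p)%:~R :> R.
  by rewrite -(ler_int R) intrD intrM -abszE in He.
have {}Hc : `|pos g|%N%:R <= (path_sum c 0 p)%:~R :> R.
  by rewrite -(ler_int R) -abszE in Hc.
have := ler_wpM2l k_ge0 He; have := ler_wpM2l (_ : 0 <= v - k * 3) Hc.
move=> /(_ ltac:(lra)); lra.
Qed.

(** Cover the distance by repeating the edge s0, and the remainder modulo s0
    by unit edges. *)
Lemma gdist_le (R : realType) (S : {fset int}) (l : int -> R)
    (S_sym : symmetric_gen S) (l_length : edge_length S l) (S_1 : 1 \in S)
    (s0 : nat) (s0_gt0 : (0 < s0)%N) (s0S : s0%:Z \in S) (x : int) :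
  gdist S l 0 x <= l s0 / s0%:R * `|x|%N%:R + s0%:R * l 1.
Proof.
pose sg (s : int) := if x < 0 then - s else s.
have sgS s : s \in S -> sg s \in S /\ l (sg s) = l s.
  move=> sS; rewrite /sg; case: ifP => _ //.
  by split; [apply: S_sym|case: (l_length _ sS)].
have [/= s0S' ls0] := sgS _ s0S; have [/= S1' lS1] := sgS _ S_1.
pose q := (`|x| %/ s0)%N; pose r := (`|x| %% s0)%N.
pose w := nseq q (sg s0) ++ nseq r (sg 1).
have s0R : 0 < s0%:R :> R by rewrite ltr0n.
have [ls0_gt0 _] := l_length _ s0S; have [l1_gt0 _] := l_length _ S_1.
apply: (@le_trans _ _ (\sum_(s <- w) l s)).
  apply: ge_inf.
    exists 0 => _ [u [uS _ ->]]; rewrite big_seq; apply: sumr_ge0 => s /uS sS.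
    by apply: ltW; case: (l_length _ sS).
  exists w; split => //.
    by move=> s; rewrite mem_cat !mem_nseq => /orP[] /andP[_ /eqP ->].
  rewrite big_cat /= !big_nseq !iter_addr_0 add0r.
  rewrite -(mulr_natr (sg s0)) -(mulr_natr (sg 1)) !natz.
  have H : `|x|%N%:Z = s0%:Z * q%:Z + r%:Z.
    by rewrite {1}(divn_eq `|x| s0) -/q -/r PoszD PoszM mulrC.
  by rewrite /sg; case: ifP => x0; rewrite ?mulNr /=; lia.
rewrite big_cat /= !big_nseq !iter_addr_0 ls0 lS1 -(mulr_natr (l s0)) -(mulr_natr (l 1)).
have -> : l s0 / s0%:R * `|x|%N%:R = l s0 * q%:R + l s0 / s0%:R * r%:R.
  rewrite (divn_eq `|x| s0) natrD natrM -/q -/r; field; lra.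
rewrite -addrA lerD2l mulrC ler_wpDl ?mulr_ge0 ?divr_ge0 ?ler0n ?(ltW ls0_gt0) //.
by rewrite ler_pM2r // ler_nat ltnW // ltn_mod.
Qed.

(** * The law of finitely many increments *)

Section CountableValues.
Variables (d : measure_display) (T : measurableType d) (R : realType).
Variables (P : probability T R) (U : countType).
Implicit Types (f : T -> U) (A : set U).

Lemma preimage_pickle f A :
  f @^-1` A = \bigcup_n (if pickle_inv n is Some u then
    if `[< A u >] then f @^-1` [set u] else set0 else set0).
Proof.
apply/seteqP; split=> [w Aw|w [n _]] /=.
  by exists (choice.pickle (f w)) => //; rewrite pickleK_inv; case: asboolP.
by case: pickle_inv => // u; case: asboolP => // Au /= ->.
Qed.

Lemma measurable_preimage_countable f A :
  (forall u, measurable (f @^-1` [set u])) -> measurable (f @^-1` A).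
Proof.
move=> fm; rewrite preimage_pickle; apply: bigcup_measurable => n _.
by case: pickle_inv => // u; case: ifP.
Qed.

(** A measure on a countable set is determined by its values on points.  The
    sets D, D' and the factor c let the same statement express independence
    (c is a probability), invariance of a law (c = 1) and nullity (c = 0). *)
Lemma countable_preimage_ext f f' A (D D' : set T) (c : R) : (0 <= c)%R ->
  (forall u, measurable (f @^-1` [set u])) ->
  (forall u, measurable (f' @^-1` [set u])) ->
  measurable D -> measurable D' ->
  (forall u, A u ->
    P (D `&` f @^-1` [set u]) = (c%:E * P (D' `&` f' @^-1` [set u]))%E) ->
  P (D `&` f @^-1` A) = (c%:E * P (D' `&` f' @^-1` A))%E.
Proof.
move=> c0 fm fm' mD mD' H.
have sumE (h : T -> U) (E : set T) : (forall u, measurable (h @^-1` [set u])) ->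
    measurable E ->
    P (E `&` h @^-1` A) =
    (\sum_(0 <= n <oo) P (E `&` (if pickle_inv n is Some u then
      if `[< A u >] then h @^-1` [set u] else set0 else set0)))%E.
  move=> hm mE; rewrite preimage_pickle setI_bigcupr measure_bigcup //.
  - by apply: eq_eseriesl => n; rewrite in_setT.
  - by move=> n _; apply: measurableI => //; case: pickle_inv => // u; case: ifP.
  - move=> i j _ _ [w [[_ wi] [_ wj]]].
    have pickle_w n : (if pickle_inv n is Some u then
        if `[< A u >] then h @^-1` [set u] else set0 else set0) w ->
        choice.pickle (h w) = n.
      have := pickle_invK (T := U) n; rewrite /ocancel.
      by case: pickle_inv => //= u un; case: ifP => // _ ->.
    by rewrite -(pickle_w _ wi) (pickle_w _ wj).
rewrite !sumE // -nneseriesZl //.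
apply: eq_eseriesr => n _; case: pickle_inv => [u|]; last by rewrite !setI0 measure0 mule0.
by case: asboolP => [/H//|_]; rewrite !setI0 measure0 mule0.
Qed.

End CountableValues.

Definition gprod (s : seq lamplighter) : lamplighter :=
  foldr (fun g h => g * h)%g 1%g s.

Lemma gprod_cat s t : gprod (s ++ t) = (gprod s * gprod t)%g.
Proof. by elim: s => [|g s IH] /=; rewrite ?mul1g // IH mulgA. Qed.

Section Increments.
Variables (d : measure_display) (T : measurableType d) (R : realType).
Variables (P : probability T R) (mu : probability lamplighter R).
Variables (inc : nat -> {RV P >-> lamplighter}).

Definition incs (ks : seq nat) (w : T) : seq lamplighter := [seq inc k w | k <- ks].

Lemma incs_cat ks ks' w : incs (ks ++ ks') w = incs ks w ++ incs ks' w.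
Proof. exact: map_cat. Qed.

Lemma walk_fromE g n w : walk_from g inc n w = (g * gprod (incs (iota 0 n) w))%g.
Proof.
elim: n => [|n IH]; first by rewrite /= mulg1.
have -> : iota 0 n.+1 = iota 0 n ++ [:: n] by rewrite -[n.+1]addn1 iotaD.
rewrite [LHS]/= IH incs_cat gprod_cat /= mulg1.
by rewrite mulgA.
Qed.

Lemma lamp_walkE n w : lamp_walk inc n w = gprod (incs (iota 0 n) w).
Proof. by rewrite /lamp_walk walk_fromE mul1g. Qed.

Lemma measurable_incs ks s : measurable (incs ks @^-1` [set s]).
Proof.
elim: ks s => [|k ks IH] s.
  case: s => [|g s].
    by rewrite (_ : _ @^-1` _ = setT) //; apply/seteqP; split.
  by rewrite (_ : _ @^-1` _ = set0) //; apply/seteqP; split.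
case: s => [|g s]; first by rewrite (_ : _ @^-1` _ = set0) //; apply/seteqP; split.
rewrite (_ : _ @^-1` _ = inc k @^-1` [set g] `&` incs ks @^-1` [set s]); last first.
  by apply/seteqP; split=> w /= [-> ->].
apply: measurableI => //; rewrite -[X in measurable X]setTI.
exact: measurable_funPT.
Qed.

Lemma measurable_incs_set ks Q : measurable (incs ks @^-1` Q).
Proof. by apply: measurable_preimage_countable => s; apply: measurable_incs. Qed.

Definition mass (s : seq lamplighter) : R := \prod_(g <- s) fine (mu [set g]).

Lemma mass_ge0 s : 0 <= mass s.
Proof. by apply: prodr_ge0 => g _; rewrite fine_ge0. Qed.

Hypothesis inc_iid : iid_with_law inc mu.

Lemma prob_incs ks s : uniq ks -> size s = size ks ->
  P (incs ks @^-1` [set s]) = (mass s)%:E.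
Proof.
move=> uks ss; have [ind law] := inc_iid.
pose A k : set lamplighter := [set nth 1%g s (index k ks)].
have -> : incs ks @^-1` [set s] =
    \bigcap_(k in [set` [fset k in ks]%fset]) (inc k @^-1` A k).
  apply/seteqP; split=> w /=.
    move=> ws k /=; rewrite inE /= => kks.
    by rewrite /A /= -ws (nth_map 0%N) ?index_mem // nth_index.
  move=> H; apply: (@eq_from_nth _ 1%g); rewrite size_map // => i il.
  rewrite (nth_map 0%N) //.
  have := H (nth 0%N ks i); rewrite /= inE /= mem_nth // => /(_ isT) ->.
  by rewrite index_uniq.
rewrite ind //.
have -> : (\prod_(k <- [fset k in ks]%fset) P (inc k @^-1` A k) =
           \prod_(k <- ks) P (inc k @^-1` A k))%E.
  by apply: perm_big; apply: uniq_perm => // k; rewrite inE.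
rewrite /mass -prodEFin (big_nth 0%N) [in RHS](big_nth 1%g) ss.
rewrite big_seq_cond [in RHS]big_seq_cond; apply: eq_bigr => i.
rewrite mem_index_iota andbT => /= il.
rewrite -[P _]/(distribution P (inc _) _) law // /A index_uniq // fineK //.
exact: fin_num_measure.
Qed.

Lemma prob_incs_indep ks ks' Q t : uniq (ks ++ ks') -> size t = size ks' ->
  P (incs ks' @^-1` [set t] `&` incs ks @^-1` Q) =
  ((mass t)%:E * P (incs ks @^-1` Q))%E.
Proof.
move=> uk st; rewrite -[X in _ = (_ * P X)%E]setTI.
apply: countable_preimage_ext => [|u|u|||u _]; rewrite ?setTI //;
  try exact: measurable_incs; first exact: mass_ge0.
have [su|su] := eqVneq (size u) (size ks); last first.
  rewrite (_ : incs ks @^-1` [set u] = set0) ?setI0 ?measure0 ?mule0 //.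
  by apply/seteqP; split=> w //= wu; rewrite -wu size_map eqxx in su.
have /and3P[uks _ _] : [&& uniq ks, ~~ has (mem ks) ks' & uniq ks'] by rewrite -cat_uniq.
rewrite (prob_incs uks su) -EFinM mulrC -[mass u * _]big_cat /=.
rewrite -(prob_incs uk) ?size_cat ?su ?st //; congr (P _).
apply/seteqP; split=> w /=; rewrite incs_cat; first by case=> -> ->.
by move/eqP; rewrite eqseq_cat ?size_map ?su // => /andP[/eqP-> /eqP->].
Qed.

Lemma prob_incs_stationary ks ks' Q : uniq ks -> uniq ks' -> size ks = size ks' ->
  P (incs ks @^-1` Q) = P (incs ks' @^-1` Q).
Proof.
move=> uk uk' sk; rewrite -[incs ks @^-1` Q]setTI -[incs ks' @^-1` Q]setTI -[RHS]mul1e.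
apply: countable_preimage_ext => [|u|u|||u _]; rewrite ?setTI ?mul1e //;
  try exact: measurable_incs.
have [su|su] := eqVneq (size u) (size ks).
  by rewrite (prob_incs uk su) (prob_incs uk') -?sk.
have incs0 js : size js = size ks -> incs js @^-1` [set u] = set0.
  move=> js_ks; apply/seteqP; split=> w //= wu.
  by rewrite -wu size_map js_ks eqxx in su.
by rewrite !incs0.
Qed.

End Increments.

(** * Words of equal length with prescribed effect on two lamps *)

Lemma lamps_mulE (g h : lamplighter) w :
  lamps (g * h)%g w = lamps g w + lamps h (w - pos g).
Proof. by rewrite /= config_addE config_shiftE. Qed.

Lemma pos_mulE (g h : lamplighter) : pos (g * h)%g = pos g + pos h.
Proof. by []. Qed.

Definition lamp_at (a : int) : config := [fsfun w in [fset a]%fset => 1].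

Lemma lamp_atE a w : lamp_at a w = if w == a then 1 else 0.
Proof. by rewrite /lamp_at fsfunE inE. Qed.

Lemma Z2_cases (z : 'Z_2) : z = 0 \/ z = 1.
Proof. by case: z => [[|[|]]] // ?; [left|right]; apply/val_inj. Qed.

Section Words.
Variables (d : measure_display) (T : measurableType d) (R : realType).
Variables (P : probability T R) (mu : probability lamplighter R).
Variables (inc : nat -> {RV P >-> lamplighter}).
Hypotheses (inc_iid : iid_with_law inc mu) (Z_irreducible : irreducible_walk inc).

Lemma reachable_word g : exists s, gprod s = g /\ 0 < mass mu s.
Proof.
have [n] := Z_irreducible 1%g g.
have -> : [set w | walk_from 1%g inc n w = g] =
    incs inc (iota 0 n) @^-1` [set s | gprod s = g].
  by apply/seteqP; split=> w /=; rewrite walk_fromE mul1g.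
move=> Pg; apply: contrapT => /forallNP H; move: Pg.
rewrite -[_ @^-1` _]setTI
  (@countable_preimage_ext _ _ _ P _ _ (incs inc (iota 0 n)) _ _ setT 0) //;
  rewrite ?mul0e ?ltxx //; try by move=> u; apply: measurable_incs.
move=> u /= ug; rewrite setTI mul0e.
have [su|su] := eqVneq (size u) (size (iota 0 n)).
  rewrite (prob_incs inc_iid) ?iota_uniq //; congr EFin.
  apply/eqP; rewrite eq_le mass_ge0 andbT leNgt; apply/negP => mu_gt0.
  by apply: (H u).
rewrite (_ : _ @^-1` _ = set0) ?measure0 //.
by apply/seteqP; split=> w //= wu; rewrite -wu size_map eqxx in su.
Qed.

Lemma mass_cat s t : mass mu (s ++ t) = mass mu s * mass mu t.
Proof. exact: big_cat. Qed.

(** Take words A, B, K, L for switching lamp 0, switching lamp 1, moving by 2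
    and moving by -2.  Arranging them in different orders does not change the
    length, the probability or the total displacement 0, but A or B acts on
    the sites 0 and 1 or on the sites 2 and 3 according to whether it stands
    outside or between K and L. *)
Lemma lamp_words : exists (M : nat) (m : R), [/\ (0 < M)%N, 0 < m &
  forall z0 z1 : 'Z_2, exists t : seq lamplighter,
    [/\ size t = M, mass mu t = m, pos (gprod t) = 0,
        lamps (gprod t) 0 = z0 & lamps (gprod t) 1 = z1]].
Proof.
have [A [gA mA]] := reachable_word (Lamplighter (lamp_at 0) 0).
have [B [gB mB]] := reachable_word (Lamplighter (lamp_at 1) 0).
have [K [gK mK]] := reachable_word (Lamplighter config0 2).
have [L [gL mL]] := reachable_word (Lamplighter config0 (- 2)).
(* A is not empty because its product is not the identity. *)
have A_gt0 : (0 < size A)%N.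
  case: A gA {mA} => //= /(congr1 (fun g => lamps g 0)).
  by rewrite /= config0E lamp_atE.
exists (size A + size B + size K + size L)%N.
exists (mass mu A * mass mu B * mass mu K * mass mu L); split.
- by rewrite !addn_gt0 A_gt0.
- by rewrite !mulr_gt0.
have ev := (gprod_cat, gA, gB, gK, gL, pos_mulE, lamps_mulE, lamp_atE, config0E).
move=> z0 z1; case: (Z2_cases z0) => ->; case: (Z2_cases z1) => ->.
- exists (K ++ A ++ B ++ L); rewrite !ev /= !size_cat !mass_cat.
  by split; rewrite ?addr0 ?add0r //; [lia|ring].
- exists (B ++ K ++ A ++ L); rewrite !ev /= !size_cat !mass_cat.
  by split; rewrite ?addr0 ?add0r //; [lia|ring].
- exists (A ++ K ++ B ++ L); rewrite !ev /= !size_cat !mass_cat.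
  by split; rewrite ?addr0 ?add0r //; [lia|ring].
- exists (A ++ B ++ K ++ L); rewrite !ev /= !size_cat !mass_cat.
  by split; rewrite ?addr0 ?add0r //; [lia|ring].
Qed.

(** * Escape and lasting pairs of lit lamps *)

Definition no_return (s : seq lamplighter) : Prop :=
  forall i, (0 < i <= size s)%N -> pos (gprod (take i s)) <> 0.

Lemma measurable_return : measurable
  [set w | exists n : nat, (0 < n)%N /\ pos (lamp_walk inc n w) = 0%R].
Proof.
rewrite (_ : mkset _ = \bigcup_(n in [set n | (0 < n)%N])
    incs inc (iota 0 n) @^-1` [set s | pos (gprod s) = 0]).
  by apply: bigcup_measurable => n _; apply: measurable_incs_set.
apply/seteqP; split=> w /= [n].
  by case=> n0 H; exists n; rewrite //= -lamp_walkE.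
by move=> /= n0 H; exists n; rewrite lamp_walkE.
Qed.

(** By stationarity the increments after any fixed time have the law of the
    walk itself, and they avoid the origin at least when the walk never comes
    back. *)
Lemma prob_no_return k r :
  (1 - P [set w | exists n : nat, (0 < n)%N /\ pos (lamp_walk inc n w) = 0%R]
   <= P (incs inc (iota k r) @^-1` no_return))%E.
Proof.
rewrite (prob_incs_stationary inc_iid _ (iota_uniq k r) (iota_uniq 0 r)); last first.
  by rewrite !size_iota.
rewrite -probability_setC; last exact: measurable_return.
apply: le_measure; rewrite ?inE; last 1 first.
- move=> w /= H i; rewrite size_map size_iota => /andP[i0 ir] wi.
  apply: H; exists i; split=> //; rewrite lamp_walkE -wi /incs -map_take take_iota.
  by rewrite (minn_idPl ir).
- by apply: measurableC; exact: measurable_return.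
- exact: measurable_incs_set.
Qed.

End Words.

(** The block of the increments j * M, ..., j * M + M - 1 marks the site a
    where it starts if it brings the walk back to a, the walk never sees a
    again after the block, and both a and a + 1 are lit at the end. *)
Definition marks_pair (M j : nat) (s : seq lamplighter) : Prop :=
  let X i := gprod (take i s) in
  let a := pos (X (j * M)%N) in
  [/\ forall i, (j.+1 * M < i <= size s)%N -> pos (X i) <> a,
      pos (X (j.+1 * M)%N) = a,
      lamps (gprod s) a != 0 & lamps (gprod s) (a + 1) != 0].

Lemma Z2_flip (z : 'Z_2) (y : 'Z_2) : z + (1 + (z + y) + y) != 0.
Proof.
rewrite (_ : z + _ = 1 + (z + z) + (y + y)); first by rewrite !Z2_addrr !addr0.
ring.
Qed.

(** A block that moves by 0 leaves the other increments acting where they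
    would act without it, so it can correct the two lamps that the past p and
    the future f leave in an arbitrary state. *)
Lemma marks_pair_cat M (p t f : seq lamplighter) (j : nat) :
  size p = (j * M)%N -> size t = M -> no_return f ->
  pos (gprod t) = 0 ->
  lamps (gprod t) 0 = 1 + (lamps (gprod p) (pos (gprod p)) + lamps (gprod f) 0) ->
  lamps (gprod t) 1 =
    1 + (lamps (gprod p) (pos (gprod p) + 1) + lamps (gprod f) 1) ->
  marks_pair M j (p ++ t ++ f).
Proof.
move=> sp st nf t0 t_0 t_1.
have tp : take (j * M)%N (p ++ t ++ f) = p by rewrite -sp take_size_cat.
have tpt : take (j.+1 * M)%N (p ++ t ++ f) = p ++ t.
  by rewrite catA take_size_cat // size_cat sp st mulSn addnC.
rewrite /marks_pair tp tpt !gprod_cat !lamps_mulE !pos_mulE t0 addr0; split=> //.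
- move=> i; rewrite !size_cat sp st => /andP[ji i_le].
  have -> : take i (p ++ t ++ f) = p ++ t ++ take (i - j.+1 * M) f.
    rewrite catA take_cat size_cat sp st addnC -mulSn ltnNge (ltnW ji) /=.
    by rewrite catA.
  rewrite !gprod_cat !pos_mulE t0 add0r -[X in _ <> X]addr0.
  move=> /addrI; apply: nf; lia.
- by rewrite subrr subr0 t_0 Z2_flip.
- by rewrite addrAC subrr add0r subr0 t_1 Z2_flip.
Qed.

Section MarkingProbability.
Variables (d : measure_display) (T : measurableType d) (R : realType).
Variables (P : probability T R) (mu : probability lamplighter R).
Variables (inc : nat -> {RV P >-> lamplighter}).
Hypotheses (inc_iid : iid_with_law inc mu) (Z_irreducible : irreducible_walk inc).
Hypothesis X_transient :
  transient_at P (0 : int) (fun n w => pos (lamp_walk inc n w)).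

(** Past and future together decide which of the four words of [lamp_words]
    the block has to be for both lamps to end up lit.  One of the four cases
    has, together with the escape of the future, probability at least a
    quarter of the escape probability e, and the block, being independent of
    past and future, is the required word with probability m. *)
Lemma prob_marks_pair : exists (M : nat) (b : R), [/\ (0 < M)%N, 0 < b &
  forall J j, (j < J)%N ->
    (b%:E <= P (incs inc (iota 0 (J * M)) @^-1` marks_pair M j))%E].
Proof.
have [M [m [M_gt0 m_gt0 words]]] := lamp_words inc_iid Z_irreducible.
set ret := [set w | exists n : nat, (0 < n)%N /\ pos (lamp_walk inc n w) = 0%R].
pose e : R := 1 - fine (P ret).
have mret : measurable ret by apply: measurable_return.
have Pret : P ret = (fine (P ret))%:E by rewrite fineK // fin_num_measure.
have e_gt0 : 0 < e.
  by rewrite subr_gt0 -lte_fin -Pret.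
have eE : e%:E = (1 - P ret)%E by rewrite Pret -EFinB.
exists M, (m * (e / 4)); split => // [|J j jJ]; first by rewrite mulr_gt0 ?divr_gt0.
set n := (J * M)%N.
have jn : (j.+1 * M <= n)%N by rewrite leq_mul2r jJ orbT.
pose r := (n - j.+1 * M)%N.
pose past := iota 0 (j * M); pose block := iota (j * M) M.
pose fut := iota (j.+1 * M) r.
(* The future starts after the block, at time (j + 1) * M. *)
have timesE : iota 0 n = past ++ block ++ fut.
  rewrite /past /block /fut; have -> : n = (j * M + (M + r))%N by rewrite /r; lia.
  by rewrite !iotaD add0n -mulSnr.
have u3 : uniq ((past ++ fut) ++ block).
  have pe : perm_eq ((past ++ fut) ++ block) (past ++ block ++ fut).
    by rewrite -catA perm_cat2l perm_catC.
  by rewrite (perm_uniq pe) -timesE iota_uniq.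
(* z is what past and future together contribute to the two lamps. *)
pose Q (z : 'Z_2 * 'Z_2) : set (seq lamplighter) := [set s |
  let p := gprod (take (j * M) s) in let f := drop (j * M) s in
  [/\ no_return f, z.1 = lamps p (pos p) + lamps (gprod f) 0 &
      z.2 = lamps p (pos p + 1) + lamps (gprod f) 1]].
have Qm z : measurable (incs inc (past ++ fut) @^-1` Q z) by apply: measurable_incs_set.
have [z Hz] : exists z, ((e / 4)%:E <= P (incs inc (past ++ fut) @^-1` Q z))%E.
  apply: contrapT => /forallNP H.
  have : (e%:E <= \sum_(z <- enum {: 'Z_2 * 'Z_2}) P (incs inc (past ++ fut) @^-1` Q z))%E.
    rewrite eE; apply: le_trans (prob_no_return inc_iid (j.+1 * M) r) _.
    rewrite (big_nth (0, 0)) big_mkord.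
    pose F i := incs inc (past ++ fut) @^-1` Q (nth (0, 0) (enum {: 'Z_2 * 'Z_2}) i).
    apply: (@content_subadditive _ _ _ P _ F).
    - by move=> k _; apply: Qm.
    - exact: measurable_incs_set.
    - move=> w /= wr. rewrite -(bigcup_mkord _ F).
      pose s := incs inc (past ++ fut) w.
      have ts : take (j * M) s = incs inc past w.
        by rewrite /s incs_cat take_size_cat // size_map size_iota.
      have ds : drop (j * M) s = incs inc fut w.
        by rewrite /s incs_cat drop_size_cat // size_map size_iota.
      pose z := (lamps (gprod (take (j * M) s)) (pos (gprod (take (j * M) s)))
          + lamps (gprod (drop (j * M) s)) 0,
          lamps (gprod (take (j * M) s)) (pos (gprod (take (j * M) s)) + 1)
          + lamps (gprod (drop (j * M) s)) 1).
      exists (index z (enum {: 'Z_2 * 'Z_2})).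
        by rewrite /= index_mem mem_enum.
      rewrite /F /= nth_index ?mem_enum //; split=> //.
      by rewrite -/s ds.
  apply/negP; rewrite -ltNge.
  have -> : e%:E = (\sum_(z <- enum {: 'Z_2 * 'Z_2}) (e / 4)%:E)%E.
    rewrite sumEFin big_const_seq count_predT -cardE card_prod !card_ord.
    by rewrite iter_addr_0 (_ : (_ * _)%N = 4%N) // -(mulr_natr (e / 4)) divfK.
  rewrite -(eq_bigr _ (fun z _ => fineK (fin_num_measure P _ (Qm z)))) !sumEFin lte_fin.
  apply: ltr_sum => [|z _].
    by apply/hasP; exists (0, 0); rewrite ?mem_enum.
  by rewrite -lte_fin fineK ?fin_num_measure // ltNge; apply/negP/H.
have [t [st mt t0 t_0 t_1]] := words (1 + z.1) (1 + z.2).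
rewrite EFinM -mt; apply: le_trans (lee_wpmul2l _ Hz) _.
  by rewrite lee_fin mass_ge0.
rewrite -(prob_incs_indep inc_iid _ u3) ?size_iota //.
apply: le_measure; rewrite ?inE.
- by apply: measurableI => //; apply: measurable_incs.
- exact: measurable_incs_set.
move=> w [/= wt [nr z1 z2]]; rewrite timesE !incs_cat wt.
move: nr z1 z2; rewrite incs_cat take_size_cat ?size_map ?size_iota //.
rewrite drop_size_cat ?size_map ?size_iota // => nr z1 z2.
by apply: marks_pair_cat; rewrite ?size_map ?size_iota // ?t_0 ?t_1 ?z1 ?z2.
Qed.

End MarkingProbability.

(** The number of events that occur has expectation at least [b * J], while this
    number is at most [b / 2 * J] outside F and at most J on F. *)
Lemma prob_many_events (d : measure_display) (T : measurableType d) (R : realType)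
    (P : probability T R) (E : nat -> set T) (F : set T) (J : nat) (b : R) :
  (0 < J)%N -> 0 <= b -> (forall j, measurable (E j)) -> measurable F ->
  (forall j, (j < J)%N -> (b%:E <= P (E j))%E) ->
  (forall w, ~ F w -> \sum_(j <- iota 0 J) \1_(E j) w <= b / 2 * J%:R) ->
  ((b / 2)%:E <= P F)%E.
Proof.
move=> J_gt0 b0 mE mF PE EF.
have PF : P F = (fine (P F))%:E by rewrite fineK // fin_num_measure.
have JR : 0 < J%:R :> R by rewrite ltr0n.
have mI j : measurable_fun setT (EFin \o (\1_(E j) : T -> R)).
  by apply/measurable_EFinP; apply: measurable_indic.
have mIF : measurable_fun setT (EFin \o (\1_F : T -> R)).
  by apply/measurable_EFinP; apply: measurable_indic.
have lo : ((b * J%:R)%:E <= \int[P]_w (\sum_(j <- iota 0 J) (\1_(E j) w)%:E))%E.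
  rewrite ge0_integral_sum //.
  apply: (@le_trans _ _ (\sum_(j <- iota 0 J) b%:E)%E).
    by rewrite sumEFin big_const_seq count_predT size_iota iter_addr_0 mulr_natr.
  rewrite [leLHS]big_seq [leRHS]big_seq; apply: lee_sum => j.
  rewrite mem_iota add0n => /= jJ.
  by rewrite integral_indic // setIT PE.
have hi : (\int[P]_w (\sum_(j <- iota 0 J) (\1_(E j) w)%:E) <=
    \int[P]_w ((b / 2 * J%:R)%:E + J%:R%:E * (\1_F w)%:E))%E.
  apply: ge0_le_integral => //.
  - by move=> w _; apply: sume_ge0 => j _; rewrite lee_fin.
  - exact: (emeasurable_sum (iota 0 J) mI).
  - by apply: emeasurable_funD => //; apply: measurable_funeM.
  - move=> w _; rewrite sumEFin -EFinM -EFinD lee_fin.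
    have [Fw|Fw] := pselect (F w).
      rewrite indicE mem_set // mulr1 ler_wpDl ?mulr_ge0 ?divr_ge0 //.
      apply: (@le_trans _ _ (\sum_(j <- iota 0 J) 1)).
        by apply: ler_sum => j _; rewrite indicE lern1 leq_b1.
      by rewrite big_const_seq count_predT size_iota iter_addr_0.
    by rewrite indicE memNset // mulr0 addr0 EF.
move: (le_trans lo hi).
rewrite ge0_integralD //; last first.
- exact: measurable_funeM.
- by move=> w _; rewrite lee_fin mulr_ge0 ?divr_ge0.
rewrite integral_cst //= probability_setT mule1 ge0_integralZl //.
rewrite integral_indic //= setIT PF -EFinM -EFinD !lee_fin => H.
have : b / 2 * J%:R <= fine (P F) * J%:R by lra.
by rewrite ler_pM2r.
Qed.

(** Distinct marking blocks mark distinct sites: a later marking block that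
    starts at the same site also ends there, after the last visit that the
    earlier one allows. *)
Lemma uniq_marked_sites M J (s : seq lamplighter) : (0 < M)%N -> size s = (J * M)%N ->
  uniq [seq pos (gprod (take (j * M) s)) | j <- iota 0 J & `[< marks_pair M j s >]].
Proof.
move=> M0 ss; rewrite map_inj_in_uniq ?filter_uniq ?iota_uniq //.
have lt_absurd i j : (i < j < J)%N -> marks_pair M i s -> marks_pair M j s ->
    pos (gprod (take (i * M) s)) <> pos (gprod (take (j * M) s)).
  move=> /andP[ij jJ] [ret _ _ _] [_ stay _ _] eq_pos.
  apply: (ret (j.+1 * M)%N); last by rewrite eq_pos.
  by rewrite ss ltn_pmul2r // leq_pmul2r // ltnS ij.
move=> i j; rewrite !mem_filter !mem_iota.
move=> /andP[/asboolP gi /= iJ] /andP[/asboolP gj /= jJ] eq_pos.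
case: (ltngtP i j) => // ij; [case: (lt_absurd i j) => //|case: (lt_absurd j i) => //];
  by rewrite ij.
Qed.

Definition marking_blocks (M J : nat) (s : seq lamplighter) : seq nat :=
  [seq j <- iota 0 J | `[< marks_pair M j s >]].

(** For each J there are at least c * J marking blocks with a probability
    bounded below, so with positive probability this happens for infinitely
    many J, and a null set cannot contain the corresponding event. *)
Lemma frequently_many_marking_blocks (d : measure_display) (T : measurableType d)
    (R : realType) (P : probability T R) (mu : probability lamplighter R)
    (inc : nat -> {RV P >-> lamplighter})
    (inc_iid : iid_with_law inc mu) (Z_irreducible : irreducible_walk inc)
    (X_transient : transient_at P (0 : int) (fun n w => pos (lamp_walk inc n w))) :
  exists (M : nat) (c : R), [/\ (0 < M)%N, 0 < c & forall N : set T,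
    P.-negligible N -> exists w, ~ N w /\ forall n0, exists J,
      [/\ (n0 <= J)%N, (0 < J)%N &
      c * J%:R <= (size (marking_blocks M J (incs inc (iota 0 (J * M)) w)))%:R]].
Proof.
have [M [b [M_gt0 b_gt0 Pmarks]]] := prob_marks_pair inc_iid Z_irreducible X_transient.
exists M, (b / 2); split; rewrite ?divr_gt0 // => N [A [mA PA NA]].
pose F J := incs inc (iota 0 (J.+1 * M)) @^-1`
  [set s | b / 2 * J.+1%:R <= (size (marking_blocks M J.+1 s))%:R].
have mF J : measurable (F J) by apply: measurable_incs_set.
have PF J : ((b / 2)%:E <= P (F J))%E.
  apply: (@prob_many_events _ _ _ P (fun j =>
    incs inc (iota 0 (J.+1 * M)) @^-1` marks_pair M j) _ J.+1) => //.
  - exact: ltW.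
  - by move=> j; apply: measurable_incs_set.
  - by move=> j; apply: Pmarks.
  move=> w /negP; rewrite -ltNge => /ltW; apply: le_trans.
  rewrite /marking_blocks size_filter -sum1_count natr_sum [leRHS]big_mkcond /=.
  apply: ler_sum => j _; rewrite indicE.
  case: asboolP => [_|H]; first by rewrite lern1 leq_b1.
  by rewrite memNset.
have PlimF : ((b / 2)%:E <= P (lim_sup_set F))%E.
  have mU n : measurable (\bigcup_(k in [set k | (n <= k)%N]) F k).
    by apply: bigcup_measurable.
  apply: (cvge_to_ge (lim_sup_set_cvg P F mF _)).
    by apply: le_lt_trans (probability_le1 _ (mU 0%N)) _; rewrite ltry.
  apply: nearW => n; apply: le_trans (PF n) _.
  apply: le_measure; rewrite ?inE //.
  by apply: bigcup_sup => /=.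
have [w [Fw Aw]] : exists w, lim_sup_set F w /\ ~ A w.
  apply: contrapT => /forallNP H.
  have : (P (lim_sup_set F) <= P A)%E.
    apply: le_measure; rewrite ?inE //.
      by apply: bigcapT_measurable => n; apply: bigcup_measurable.
    by move=> w Fw; apply: contrapT => Aw; apply: (H w).
  move=> /(le_trans PlimF); rewrite [X in (_ <= X)%E]PA lee_fin.
  by apply/negP; rewrite -ltNge divr_gt0.
exists w; split=> [/NA//|n0]; have [J /= n0J FJ] := Fw n0 I.
by exists J.+1; split=> //; apply: leq_trans n0J _.
Qed.

Lemma TS_length_ge_marking_blocks (d : measure_display) (T : measurableType d)
    (R : realType) (P : probability T R) (inc : nat -> {RV P >-> lamplighter})
    (S : {fset int}) (l : int -> R) (S_gen : semigroup_generates S)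
    (l1 : forall s, s \in S -> `|s|%N = 1%N -> l s = l 1)
    (v k : R) (k_ge0 : 0 <= k) (k_v : k * 3 <= v) (k_l : v + k <= l 1)
    (v_min : forall s, s \in S -> v * `|s|%N%:R <= l s) (M J : nat) (w : T) :
  (0 < M)%N ->
  v * `|pos (lamp_walk inc (J * M) w)|%N%:R
    + k * (size (marking_blocks M J (incs inc (iota 0 (J * M)) w)))%:R
  <= TS_length S l (lamp_walk inc (J * M) w).
Proof.
move=> M_gt0; rewrite lamp_walkE; set s := incs _ _ _.
have ss : size s = (J * M)%N by rewrite size_map size_iota.
rewrite -(size_map (fun j => pos (gprod (take (j * M) s)))).
apply: TS_length_ge => //; first exact: uniq_marked_sites.
move=> a /mapP[j]; rewrite mem_filter => /andP[/asboolP[_ _ lit lit1] _] ->.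
by rewrite !mem_finsupp.
Qed.

(** * Comparison of the rates of escape *)

Theorem corollary4p8 (R : realType)
  (S : {fset int}) (l : int -> R)
  (S_neq0 : 0 \notin S)
  (S_sym : symmetric_gen S)
  (S_gen : semigroup_generates S)
  (l_length : edge_length S l)
  (S_1 : 1 \in S) (S_N1 : -1 \in S)
  (S_card : (3 <= #|` S|)%N)
  (l_short : exists s : int,
     [/\ s \in S, s != 1, s != -1 & l s < `|s|%:~R * l 1])
  (cL : R) (cL_ge0 : 0 <= cL)
  (d : measure_display) (T : measurableType d) (P : probability T R)
  (mu : probability lamplighter R)
  (inc : nat -> {RV P >-> lamplighter})
  (inc_iid : iid_with_law inc mu)
  (Z_irreducible : irreducible_walk inc)
  (Z_transient : transient_at P (1%g : lamplighter) (lamp_walk inc))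
  (mu_gen : subgroup_generated (law_support mu) = [set: lamplighter])
  (mu_lamps : exists K : R, 0 <= K /\
     forall g : lamplighter, law_support mu g ->
       forall y : int, y \in finsupp (lamps g) -> gdist S l 0 y <= K)
  (mu_moment :
     (\esum_(g in [set: lamplighter]) ((gdist S l 0 (pos g))%:E * mu [set g])
        < +oo)%E)
  (X_transient : transient_at P (0 : int) (fun n w => pos (lamp_walk inc n w)))
  (ell0 ellTS ell : R)
  (ell0_rate : as_rate P
     (fun n w => gdist S l 0 (pos (lamp_walk inc n w))) ell0)
  (ellTS_rate : as_rate P
     (fun n w => TS_length S l (lamp_walk inc n w)) ellTS)
  (ell_rate : as_rate P
     (fun n w => lamp_length S l cL (lamp_walk inc n w)) ell) :
  ellTS <= ell /\ ell0 < ellTS.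
Proof.
(* The rates are constants: one outcome at which all three limits exist and
   there are linearly many marking blocks infinitely often is enough. *)
have [M [c [M_gt0 c_gt0 frequent]]] :=
  frequently_many_marking_blocks inc_iid Z_irreducible X_transient.
have [w [/contrapT[[rate0 rateTS] rate] many]] := frequent _
  (filterI (filterI ell0_rate ellTS_rate) ell_rate).
have [s0 [s0_gt0 s0S v_min]] := efficient_edge S_neq0 S_sym l_length S_1.
set v := l s0 / s0%:R in v_min.
have v_gt0 : 0 < v by rewrite divr_gt0 ?ltr0n //; case: (l_length _ s0S).
have v_lt : v < l 1.
  have [s [sS _ _]] := l_short; rewrite -abszE => /(le_lt_trans (v_min s sS)).
  rewrite [X in _ < X]mulrC ltr_pM2r // ltr0n absz_gt0.
  by apply: contraNneq S_neq0 => <-.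
have l1 s : s \in S -> `|s|%N = 1%N -> l s = l 1.
  by case: (intP s) => [|n|n] // sS [->] //; case: (l_length _ S_1).
(* One unit of [edge_cost] is a third of a unit of displacement, which costs at
   least v / 3, or the surcharge of a unit edge, which is l 1 - v too long. *)
pose k : R := Num.min (v / 3) (l 1 - v).
have k_gt0 : 0 < k by rewrite lt_min divr_gt0 // subr_gt0.
have k_v : k * 3 <= v by rewrite -ler_pdivlMr // ge_min lexx.
have k_l : v + k <= l 1 by rewrite -lerBrDl ge_min lexx orbT.
have TS_ge := TS_length_ge_marking_blocks inc S_gen l1 (ltW k_gt0) k_v k_l v_min _ w M_gt0.
split.
  apply: ler_cvg_to rateTS rate _; apply: nearW => n.
  by rewrite ler_wpM2r ?invr_ge0 // lerDl mulr_ge0.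
have [C dist_le] : exists C, forall x, gdist S l 0 x <= v * `|x|%N%:R + C.
  by exists (s0%:R * l 1); apply: gdist_le.
pose r := k * c / M%:R.
have MR : 0 < M%:R :> R by rewrite ltr0n.
have r_gt0 : 0 < r by rewrite divr_gt0 ?mulr_gt0.
rewrite ltNge; apply/negP => ell_le.
have lt_r : ellTS - ell0 < r / 2 by lra.
have [n1 _ small] := cvgr_lt _ (cvgB rateTS rate0) _ lt_r.
have [J [J_ge J_gt0 J_many]] := many (n1 + Num.bound `|C * 2 / r|)%N.
have JM_R : 0 < (J * M)%:R :> R by rewrite ltr0n muln_gt0 J_gt0.
have : TS_length S l (lamp_walk inc (J * M) w) / (J * M)%:R
    - gdist S l 0 (pos (lamp_walk inc (J * M) w)) / (J * M)%:R < r / 2.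
  apply: small => /=; apply: leq_trans (leq_pmulr J M_gt0).
  exact: leq_trans (leq_addr _ _) J_ge.
apply/negP; rewrite -leNgt -mulrBl ler_pdivlMr // natrM.
(* The bounded error C is at most half of the gain r * (J * M). *)
have C_le : C * 2 <= r * (J%:R * M%:R).
  have Cr : C * 2 / r <= J%:R.
    apply: le_trans (ler_norm _) (le_trans (ltW (archi_boundP (normr_ge0 _))) _).
    by rewrite ler_nat (leq_trans _ J_ge) ?leq_addl.
  apply: le_trans (_ : r * J%:R <= _); first by rewrite -ler_pdivrMl // mulrC.
  by rewrite ler_pM2l // ler_peMr // ler1n.
have -> : r / 2 * (J%:R * M%:R) = r * (J%:R * M%:R) - r * (J%:R * M%:R) / 2 by field.
have rJM : r * (J%:R * M%:R) = k * (c * J%:R) by rewrite /r; field; lra.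
have := ler_wpM2l (ltW k_gt0) J_many.
have := TS_ge J; have := dist_le (pos (lamp_walk inc (J * M) w)).
lra.
Qed.
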